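(* Let $X$ be a Fréchet Dacey space and let $p \colon X \to X$ be a map. Then $p$ is a projection if and only if $p$ is idempotent and self-adjoint.
   Context: An orthoset (with $0$) is a non-empty set $X$ with a binary relation $\perp$ and a distinguished element $0$ such that: $x \perp y$ implies $y \perp x$; $x \perp x$ iff $x = 0$; $0 \perp x$ for all $x$. Elements $\neq 0$ are proper. For $A \subseteq X$, $A^\perp = \{x : x \perp y \ \forall y \in A\}$; subspaces are sets with $A = A^{\perp\perp}$; $\mathsf{C}(X)$ is the ortholattice of subspaces; a subset containing $0$ with the restricted relation is an orthoset. $X$ is Fréchet if for any distinct proper $x,y$ there is $z$ with $z \perp x$, $z \not\perp y$; $X$ is Dacey if $\mathsf{C}(X)$ is orthomodular. A map $g$ is an adjoint of $f \colon X \to Y$ if $f(x) \perp y \iff x \perp g(y)$ for all $x,y$; $p \colon X \to X$ is self-adjoint if $p$ is an adjoint of itself. An orthoisomorphism is a bijection $h$ with $h(0)=0$ and $x \perp y \iff h(x)\perp h(y)$. $\ker f = \{x : f(x)=0\}$, $\operatorname{im} f = f(X)$. A map $f \colon X \to Y$ is a partial orthometry if it has an adjoint $g$ such that for some subspaces $A$ of $X$, $B$ of $Y$, $A^\perp = \ker f$, $B^\perp = \ker g$, and $f,g$ restrict to mutually inverse orthoisomorphisms between $A$ and $B$. For an adjointable $f$, its zero-kernel restriction is $f$ restricted to $(\ker f)^\perp$ with codomain $(\operatorname{im} f)^{\perp\perp}$. A projection (onto a subspace $A$) is a partial orthometry $p \colon X \to X$ whose zero-kernel restriction is $\mathrm{id}_A$.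 *)

(* Defs.v *)
From HB Require Import structures.
From mathcomp Require Import ssreflect ssrfun ssrbool eqtype.
From mathcomp Require Import mathcomp_extra boolp classical_sets functions.

Set Implicit Arguments.
Unset Strict Implicit.
Unset Printing Implicit Defensive.

Local Open Scope classical_set_scope.

(* Non-emptiness of the carrier is witnessed by ozero. *)
HB.mixin Record isOrthoset X := {
  orth : X -> X -> Prop;
  ozero : X;
  orth_sym : forall x y, orth x y -> orth y x;
  orth_self : forall x, orth x x <-> x = ozero;
  orth0x : forall x, orth ozero x
}.

#[short(type="orthosetType")]
HB.structure Definition Orthoset := { X of isOrthoset X }.

Notation "x ⊥ y" := (orth x y) (at level 70, no associativity).

Section Subspaces.
Variable X : orthosetType.
Implicit Types (x y : X) (A B C : set X).

Definition proper x := x <> ozero.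

Definition orthocompl A : set X := [set x | forall y, A y -> x ⊥ y].

Definition subspace A := A = orthocompl (orthocompl A).

(* C(X) consists of the subspaces ordered by inclusion; its meet is set
   intersection, its join is subspace_join and its orthocomplementation is
   orthocompl, as the lemmas below confirm. *)
Definition subspace_join A B := orthocompl (orthocompl (A `|` B)).

Definition frechet := forall x y, proper x -> proper y -> x <> y ->
  exists z, z ⊥ x /\ ~ z ⊥ y.

(* Orthomodular law of C(X). *)
Definition dacey := forall A B, subspace A -> subspace B -> A `<=` B ->
  B = subspace_join A (B `&` orthocompl A).

Lemma orthocomplS A B : A `<=` B -> orthocompl B `<=` orthocompl A.
Proof. by move=> AB x xB y Ay; apply: xB; apply: AB. Qed.

Lemma sub_biorthocompl A : A `<=` orthocompl (orthocompl A).
Proof. by move=> x Ax y yA; apply: orth_sym; apply: yA. Qed.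

Lemma subspace_orthocompl A : subspace (orthocompl A).
Proof.
apply/seteqP; split; first exact: sub_biorthocompl.
exact/orthocomplS/sub_biorthocompl.
Qed.

Lemma subspaceI A B : subspace A -> subspace B -> subspace (A `&` B).
Proof.
move=> sA sB; apply/seteqP; split; first exact: sub_biorthocompl.
move=> x xAB; split.
- by rewrite sA; apply: orthocomplS xAB; apply: orthocomplS => ? [].
- by rewrite sB; apply: orthocomplS xAB; apply: orthocomplS => ? [].
Qed.

Lemma subspace_joinP A B C : subspace C ->
  subspace_join A B `<=` C <-> A `<=` C /\ B `<=` C.
Proof.
move=> sC; split=> [ABC|[AC BC]].
  by split=> x Hx; apply: ABC; apply: sub_biorthocompl; [left|right].
rewrite sC; apply: orthocomplS; apply: orthocomplS => x.
by case=> [/AC|/BC].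
Qed.

Lemma orthocompl_meet A : subspace A -> A `&` orthocompl A = [set ozero].
Proof.
move=> sA; apply/seteqP; split=> x /=.
  by case=> Ax xA; apply/orth_self/xA.
by move=> ->; split; [rewrite sA|]; move=> y _; apply: orth0x.
Qed.

Lemma orthocompl_join A : subspace_join A (orthocompl A) = setT.
Proof.
apply/seteqP; split=> // x _ y yA.
suff -> : y = ozero by apply/orth_sym/orth0x.
have yC : orthocompl A y by move=> z Az; apply: yA; left.
by apply/orth_self; apply: yA; right.
Qed.

End Subspaces.

Section Maps.
Variables X Y : orthosetType.
Implicit Types (f : X -> Y) (A : set X) (B : set Y).

Definition is_adjoint f (g : Y -> X) := forall x y, f x ⊥ y <-> x ⊥ g y.

Definition oker f : set X := [set x | f x = ozero].

(* f restricts to an orthoisomorphism from A to B, both carrying the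
   orthoset structure induced by the ambient one. *)
Definition orthoiso_on A B f :=
  [/\ set_bij A B f, f ozero = ozero &
      forall x y, A x -> A y -> (x ⊥ y <-> f x ⊥ f y)].

Definition zero_kernel_dom f : set X := orthocompl (oker f).
Definition zero_kernel_cod f : set Y := orthocompl (orthocompl (range f)).

Lemma zero_kernel_subproof f (x : zero_kernel_dom f) :
  f (\val x) \in zero_kernel_cod f.
Proof. by apply/mem_set/sub_biorthocompl; exists (\val x). Qed.

Definition zero_kernel_restriction f (x : zero_kernel_dom f) :
  zero_kernel_cod f := SigSub (zero_kernel_subproof x).

End Maps.

Definition partial_orthometry (X Y : orthosetType) (f : X -> Y) :=
  exists g : Y -> X, is_adjoint f g /\
  exists (A : set X) (B : set Y), [/\ subspace A, subspace B,
    orthocompl A = oker f, orthocompl B = oker g &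
    [/\ orthoiso_on A B f, orthoiso_on B A g,
        {in A, cancel f g} & {in B, cancel g f}]].

Section Projections.
Variable X : orthosetType.
Implicit Types (p : X -> X) (A : set X).

Definition self_adjoint p := is_adjoint p p.

(* The condition zero_kernel_restriction p = id_A comprises the equality of
   domains and of codomains. *)
Definition projection_onto A p :=
  [/\ subspace A, partial_orthometry p,
      zero_kernel_dom p = A, zero_kernel_cod p = A &
      forall x : zero_kernel_dom p,
        \val (zero_kernel_restriction x) = \val x].

Definition projection p := exists A, projection_onto A p.

End Projections.

(* Main.v *)
(* If [p] is idempotent and self-adjoint, then [ker p = (im p)^⊥], and the point
   is that [p] fixes every [x] in [A = (ker p)^⊥].  Put [u = p x] and
   [D = {u, x}^⊥⊥].  If [y] in [D] is orthogonal to [u], then [p y ⊥ x] and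
   [p y ⊥ u], so [p y ⊥ y], whence [p y = 0] and [y] lies in [A] and in [ker p];
   thus [y = 0].  Orthomodularity gives [D = {u}^⊥⊥], so [x] is in [{u}^⊥⊥], and
   the Fréchet property forces [x = u]. *)
(* Imported before [Defs], whose [proper] must shadow that of [classical_sets]. *)
From mathcomp Require Import boolp classical_sets functions.
Require Import Defs.
From mathcomp Require Import ssreflect ssrfun ssrbool eqtype.

Set Implicit Arguments.
Unset Strict Implicit.
Unset Printing Implicit Defensive.

Local Open Scope classical_set_scope.

Section Orthocomplement.
Variable X : orthosetType.
Implicit Types (x y : X) (A B : set X).

Lemma orthx0 x : x ⊥ ozero.
Proof. exact/orth_sym/orth0x. Qed.

Lemma orthocompl_meet0 A x : A x -> orthocompl A x -> x = ozero.
Proof. by move=> Ax xA; apply/orth_self/xA. Qed.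

(** The orthomodular law writes [B] as the join of [A] and [B ∩ A^⊥]; the second term vanishes, so
    the join collapses to [A]. *)
Lemma dacey_eq A B : dacey X -> subspace A -> subspace B -> A `<=` B ->
  B `&` orthocompl A `<=` [set ozero] -> A = B.
Proof.
move=> hD sA sB AB BA0; apply/seteqP; split=> //.
rewrite (hD _ _ sA sB AB); apply/subspace_joinP => //; split=> // x /BA0 /= ->.
by rewrite sA => y _; apply: orth0x.
Qed.

(** If [x] and [y] differed, some [z] in [{y}^⊥] would fail to be orthogonal to [x], contradicting
    [x ∈ {y}^⊥⊥]. *)
Lemma frechet_eq x y : frechet X -> proper x -> proper y ->
  orthocompl (orthocompl [set y]) x -> x = y.
Proof.
move=> hF x0 y0 xy; apply/not_notP => nxy.
have [z [zy nzx]] := hF y x y0 x0 (nesym nxy).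
by apply/nzx/orth_sym/xy => _ ->.
Qed.

End Orthocomplement.

(** For the harder inclusion, test [y] against [f (g y)]: this yields [g y ⊥ g y]. *)
Lemma oker_adjoint (X Y : orthosetType) (f : X -> Y) (g : Y -> X) :
  is_adjoint f g -> oker g = orthocompl (range f).
Proof.
move=> fg; apply/seteqP; split=> y.
  by move=> /= gy _ [x _ <-]; apply/orth_sym/fg; rewrite gy; apply: orthx0.
by move=> yf; apply/orth_self/fg/orth_sym/yf; exists (g y).
Qed.

Section Projections.
Variables (X : orthosetType) (p : X -> X).

Lemma projection_idempotent_self_adjoint :
  projection p -> idempotent_fun p /\ self_adjoint p.
Proof.
case=> A [sA [g [pg [A' [B [sA' sB kp kg [_ _ pK gK]]]]]] domA codA idA].
have pA x : A x -> p x = x.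
  by rewrite -domA => Ax; have := idA (SigSub (mem_set Ax)).
have rA x : A (p x).
  by rewrite -codA; apply: sub_biorthocompl; exists x.
(* The subspaces [A'] and [B] are determined by their complements, [ker p] and [ker g = (im p)^⊥],
   so both equal [A]; hence [g] fixes [A] as [p] does. *)
have AA' : A' = A by rewrite sA' kp.
have BA : B = A by rewrite sB kg (oker_adjoint pg).
have gA y : A y -> g y = y.
  by move=> Ay; rewrite -{1}[y]pA // pK // AA'; apply: mem_set.
split; first by move=> x /=; rewrite pA.
move=> x y.
(* Adjointness turns [p y ⊥ p x] into [y ⊥ g (p x)], and [g] fixes [p x]. *)
have -> : p x ⊥ y <-> p x ⊥ p y.
  have -> : p x ⊥ p y <-> p y ⊥ p x by split; apply: orth_sym.
  by rewrite (pg y) gA //; split; apply: orth_sym.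
by rewrite (pg x) gA.
Qed.

Hypotheses (pp : idempotent_fun p) (sp : self_adjoint p).

Let ppE x : p (p x) = p x. Proof. exact: pp. Qed.

Lemma self_adjoint_idempotent_orth y : p y ⊥ y -> p y = ozero.
Proof. by rewrite -{1}(ppE y) => /sp/orth_self. Qed.

Lemma idempotent_self_adjoint_fix x : frechet X -> dacey X ->
  zero_kernel_dom p x -> p x = x.
Proof.
move=> hF hD Ax.
have kA y : oker p y -> zero_kernel_dom p y -> y = ozero.
  exact: orthocompl_meet0.
have Apx : zero_kernel_dom p (p x).
  by rewrite /zero_kernel_dom (oker_adjoint sp); apply: sub_biorthocompl; exists x.
set C := orthocompl (orthocompl [set p x]).
set D := orthocompl (orthocompl [set p x; x]).
have DA : D `<=` zero_kernel_dom p.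
  rewrite [zero_kernel_dom p]subspace_orthocompl.
  by apply/orthocomplS/orthocomplS => _ [] ->.
have CD : C = D.
  apply: (dacey_eq hD); try exact: subspace_orthocompl.
    by apply/orthocomplS/orthocomplS => _ ->; left.
  move=> y [Dy yC]; apply: kA (DA _ Dy).
  have ypx : y ⊥ p x by apply/yC/sub_biorthocompl.
  apply/self_adjoint_idempotent_orth/orth_sym/Dy => _ [] ->.
    by apply/sp; rewrite ppE.
  exact/sp.
have Cx : C x by rewrite CD; apply: sub_biorthocompl; right.
(* [frechet_eq] compares proper elements only. If [x] is proper, so is [p x]: otherwise [x] would
   lie in both [ker p] and its complement. *)
have [x0|x0] := pselect (x = ozero).
  by rewrite x0; apply/orth_self/sp/orth0x.
apply/esym/frechet_eq => //.
by move=> px0; apply: x0; apply: kA.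
Qed.

Lemma idempotent_self_adjoint_projection : frechet X -> dacey X -> projection p.
Proof.
move=> hF hD; pose A := zero_kernel_dom p.
have fixA x : A x -> p x = x by exact: idempotent_self_adjoint_fix.
have sA : subspace A by exact: subspace_orthocompl.
have kA : orthocompl A = oker p.
  (* Being the orthocomplement of [im p], the kernel is biorthogonally closed. *)
  by rewrite /A /zero_kernel_dom (oker_adjoint sp) -subspace_orthocompl.
have pK : {in A, cancel p p} by move=> x /set_mem Ax; rewrite !fixA.
have iso : orthoiso_on A A p.
  split; last by move=> x y Ax Ay; rewrite !fixA.
  - split.
    + by move=> x Ax /=; rewrite fixA.
    + by move=> x y /set_mem Ax /set_mem Ay; rewrite !fixA.
    + by move=> x Ax; exists x => //; rewrite fixA.
  - by apply/orth_self/sp/orth0x.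
exists A; split=> //.
- by exists p; split=> //; exists A, A; split.
- by rewrite /A /zero_kernel_dom (oker_adjoint sp).
- by move=> [x Ax] /=; apply: fixA; apply: set_mem.
Qed.

End Projections.

Theorem theorem4p14 (X : orthosetType) (p : X -> X)
    (hF : frechet X) (hD : dacey X) :
  projection p <-> idempotent_fun p /\ self_adjoint p.
Proof.
split; first exact: projection_idempotent_self_adjoint.
by case=> pp sp; apply: idempotent_self_adjoint_projection.
Qed.
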